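(* Let $\beta\ge 0$ and consider the weighted minimum density power divergence (DPD) estimator of $\boldsymbol{\theta}=(\boldsymbol{\eta},\boldsymbol{\alpha})\in\mathbb{R}^I\times\mathbb{R}^J$, that is, the minimizer of the objective function $D_\beta(\boldsymbol{\eta},\boldsymbol{\alpha})$ defined in the context. The estimating equations $\frac{\partial}{\partial\boldsymbol{\eta}}D_\beta(\boldsymbol{\eta},\boldsymbol{\alpha})=\boldsymbol{0}_I$ and $\frac{\partial}{\partial\boldsymbol{\alpha}}D_\beta(\boldsymbol{\eta},\boldsymbol{\alpha})=\boldsymbol{0}_J$ are given (equivalently) by, writing $R_{is}=R(IT_i,\boldsymbol{x}_s;\boldsymbol{\eta},\boldsymbol{\alpha})$, $$\sum_{i=1}^{I}\sum_{s=1}^{S}\delta_{is}(\boldsymbol{\eta})\left(K_{is}(1-R_{is})-n_{is}\right)\left[(1-R_{is})^{\beta-1}+R_{is}^{\beta-1}\right]=\boldsymbol{0}_{I},$$ $$\sum_{i=1}^{I}\sum_{s=1}^{S}\delta_{is}(\boldsymbol{\alpha})\left(K_{is}(1-R_{is})-n_{is}\right)\left[(1-R_{is})^{\beta-1}+R_{is}^{\beta-1}\right]=\boldsymbol{0}_{J},$$ where $$\delta_{is}(\boldsymbol{\eta})=\frac{\partial R(IT_i,\boldsymbol{x}_s;\boldsymbol{\eta},\boldsymbol{\alpha})}{\partial\boldsymbol{\eta}}=-(1-G_i)^{\lambda(\boldsymbol{x}_s;\boldsymbol{\alpha})-1}\lambda(\boldsymbol{x}_s;\boldsymbol{\alpha})\frac{\partial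 G_i}{\partial\boldsymbol{\eta}},$$ $$\delta_{is}(\boldsymbol{\alpha})=\frac{\partial R(IT_i,\boldsymbol{x}_s;\boldsymbol{\eta},\boldsymbol{\alpha})}{\partial\boldsymbol{\alpha}}=(1-G_i)^{\lambda(\boldsymbol{x}_s;\boldsymbol{\alpha})}\log(1-G_i)\,\lambda(\boldsymbol{x}_s;\boldsymbol{\alpha})\,\boldsymbol{x}_s,$$ with, for $u=1,\dots,I$, $$\frac{\partial G_i}{\partial\eta_u}=\begin{cases}\exp(\eta_u)\exp(-\exp(\eta_u))\,G_i/\gamma(\eta_u), & i\le u,\\ 0, & i>u.\end{cases}$$
   Context: Data: $I,S,J\ge 1$ are integers; $0<IT_1<\cdots<IT_I$ are inspection times; $\boldsymbol{x}_s=(x_{s1},\dots,x_{sJ})\in\mathbb{R}^J$, $s=1,\dots,S$, are stress-level vectors. At inspection time $IT_i$ under stress $\boldsymbol{x}_s$, $K_{is}\ge 1$ devices are tested and $n_{is}\in\{0,\dots,K_{is}\}$ of them have failed. $K=\sum_{i,s}K_{is}$. Model: $\boldsymbol{\eta}=(\eta_1,\dots,\eta_I)\in\mathbb{R}^I$, $\boldsymbol{\alpha}=(\alpha_1,\dots,\alpha_J)\in\mathbb{R}^J$; $\gamma(\eta_m)=1-\exp(-\exp(\eta_m))$; $G_i=\prod_{m=i}^I\gamma(\eta_m)$; $\lambda(\boldsymbol{x}_s;\boldsymbol{\alpha})=\exp(\sum_{j=1}^J\alpha_jx_{sj})$; $R(IT_i,\boldsymbol{x}_s;\boldsymbol{\eta},\boldsymbol{\alpha})=(1-G_i)^{\lambda(\boldsymbol{x}_s;\boldsymbol{\alpha})}\in(0,1)$.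 Put $\pi_{is1}=1-R(IT_i,\boldsymbol{x}_s;\boldsymbol{\eta},\boldsymbol{\alpha})$, $\pi_{is2}=R(IT_i,\boldsymbol{x}_s;\boldsymbol{\eta},\boldsymbol{\alpha})$, $\widehat p_{is1}=n_{is}/K_{is}$, $\widehat p_{is2}=(K_{is}-n_{is})/K_{is}$. Objective function: $D_\beta(\boldsymbol{\eta},\boldsymbol{\alpha})=\sum_{i=1}^I\sum_{s=1}^S\frac{K_{is}}{K}d^{*}_{\beta,is}(\boldsymbol{\eta},\boldsymbol{\alpha})$, where for $\beta>0$ $$d^{*}_{\beta,is}=\left(\pi_{is1}^{\beta+1}+\pi_{is2}^{\beta+1}\right)-\frac{\beta+1}{\beta}\left(\widehat p_{is1}\pi_{is1}^{\beta}+\widehat p_{is2}\pi_{is2}^{\beta}\right),$$ and for $\beta=0$ it is the Kullback-Leibler divergence $d^{*}_{0,is}=\widehat p_{is1}\log(\widehat p_{is1}/\pi_{is1})+\widehat p_{is2}\log(\widehat p_{is2}/\pi_{is2})$ (with $0\log 0=0$). The weighted minimum DPD estimator is $\widehat{\boldsymbol{\theta}}_\beta=\arg\min_{\boldsymbol{\theta}}D_\beta$; for $\beta=0$ it is the maximum likelihood estimator. $\boldsymbol{0}_d$ denotes the zero vector of length $d$. *)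

(* Defs.v *)
From mathcomp Require Export all_boot all_order all_algebra.
From mathcomp Require Export all_classical all_reals all_analysis.

Set Implicit Arguments.
Unset Strict Implicit.
Unset Printing Implicit Defensive.

Export Order.TTheory GRing.Theory Num.Theory.
Export numFieldNormedType.Exports.
Local Open Scope ring_scope.

Definition has_partials (R : realType) (d : nat) (f : 'rV[R]_d -> R)
    (a : 'rV[R]_d) : Prop :=
  forall u : 'I_d, derivable f a (delta_mx 0 u).

(* 'D_v is a totalized limit, so this is the vector of partial derivatives
   only under has_partials f a. *)
Definition grad (R : realType) (d : nat) (f : 'rV[R]_d -> R)
    (a : 'rV[R]_d) : 'rV[R]_d :=
  \row_(u < d) 'D_(delta_mx 0 u) f a.

Definition gam (R : realType) (t : R) : R := 1 - expR (- expR t).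

(* Inspection times are indexed from 0: i : 'I_I stands for IT_(i+1). *)
Definition G (R : realType) (I : nat) (i : 'I_I) (eta : 'rV[R]_I) : R :=
  \prod_(m < I | (i <= m)%N) gam (eta 0 m).

Definition lam (R : realType) (J : nat) (xs alpha : 'rV[R]_J) : R :=
  expR (\sum_(j < J) alpha 0 j * xs 0 j).

(* R(IT_i, xs; eta, alpha): the model depends on IT_i only through i. *)
Definition rel_at (R : realType) (I J : nat) (i : 'I_I) (xs : 'rV[R]_J)
    (eta : 'rV[R]_I) (alpha : 'rV[R]_J) : R :=
  (1 - G i eta) `^ lam xs alpha.

Definition delta_eta (R : realType) (I J : nat) (i : 'I_I) (xs : 'rV[R]_J)
    (eta : 'rV[R]_I) (alpha : 'rV[R]_J) : 'rV[R]_I :=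
  grad (fun e => rel_at i xs e alpha) eta.

Definition delta_alpha (R : realType) (I J : nat) (i : 'I_I) (xs : 'rV[R]_J)
    (eta : 'rV[R]_I) (alpha : 'rV[R]_J) : 'rV[R]_J :=
  grad (fun a => rel_at i xs eta a) alpha.

(* d*_beta between (p1, p2) and (pi1, pi2).  For beta = 0 the convention
   0 log 0 = 0 holds because the logarithm is multiplied by p1 (resp. p2). *)
Definition dpd (R : realType) (beta p1 p2 pi1 pi2 : R) : R :=
  if beta == 0 then p1 * ln (p1 / pi1) + p2 * ln (p2 / pi2)
  else (pi1 `^ (beta + 1) + pi2 `^ (beta + 1))
       - (beta + 1) / beta * (p1 * pi1 `^ beta + p2 * pi2 `^ beta).

Definition Ktot (I S : nat) (K : 'I_I -> 'I_S -> nat) : nat :=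
  (\sum_(i < I) \sum_(s < S) K i s)%N.

Definition Dobj (R : realType) (I S J : nat) (x : 'I_S -> 'rV[R]_J)
    (K n : 'I_I -> 'I_S -> nat) (beta : R)
    (eta : 'rV[R]_I) (alpha : 'rV[R]_J) : R :=
  \sum_(i < I) \sum_(s < S)
    (K i s)%:R / (Ktot K)%:R *
    dpd beta ((n i s)%:R / (K i s)%:R)
             (((K i s)%:R - (n i s)%:R) / (K i s)%:R)
             (1 - rel_at i (x s) eta alpha) (rel_at i (x s) eta alpha).

(* Weighted minimum DPD estimate; for beta = 0, the maximum likelihood one. *)
Definition is_wmdpde (R : realType) (I S J : nat) (x : 'I_S -> 'rV[R]_J)
    (K n : 'I_I -> 'I_S -> nat) (beta : R)
    (eta : 'rV[R]_I) (alpha : 'rV[R]_J) : Prop :=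
  forall (eta' : 'rV[R]_I) (alpha' : 'rV[R]_J),
    Dobj x K n beta eta alpha <= Dobj x K n beta eta' alpha'.

(* Main.v *)
(** Each summand of the objective is phi(R_is), where phi(r) is the divergence
    between (p1, p2) and (1 - r, r).  Since p1 + p2 = 1, both r - p2 and
    p1 - (1 - r) are the same number, so phi'(r) factors as
    -(beta + 1) (1 - r - p1) ((1 - r)^(beta - 1) + r^(beta - 1)), uniformly in
    beta >= 0.  By the chain rule the gradient of the objective is therefore the
    left-hand side of the estimating equations times the nonzero constant
    -(beta + 1) / Ktot.  Directional derivatives suffice throughout, because
    each one is an ordinary derivative along a line. *)

Require Import Defs.
From mathcomp Require Import ring.
Set Implicit Arguments.
Unset Strict Implicit.
Unset Printing Implicit Defensive.
Local Open Scope ring_scope.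

(** * Directional derivatives, gradients and critical points *)

(** Both difference quotients are the same function of [h], since [h *: 1 + 0] is [h]. Calculus on
    row vectors thus reduces to one real variable. *)
Lemma is_derive_lineP (R : realType) (V W : normedModType R) (f : V -> W)
    (a v : V) (df : W) :
  is_derive a v f df <-> is_derive (0 : R) (1 : R) (fun h => f (h *: v + a)) df.
Proof.
have eqD : 'D_v f a = 'D_1 (fun h : R => f (h *: v + a)) 0.
  rewrite /derive; set g1 := fun h => h^-1 *: _; set g2 := fun h => h^-1 *: _.
  suff -> : g1 = g2 by [].
  by apply/funext => h; rewrite /g1 /g2/= addr0 scale0r add0r [_%:A]mulr1.
split=> -[fv <-].
- by apply: DeriveDef; [exact: (derivable1P f a v).1|rewrite eqD].
- by apply: DeriveDef; [exact: (derivable1P f a v).2|rewrite eqD].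
Qed.

Lemma is_derive_comp (R : realType) (V : normedModType R) (g : R -> R)
    (f : V -> R) (a v : V) (dg df : R) :
  is_derive (f a) 1 g dg -> is_derive a v f df ->
  is_derive a v (fun e => g (f e)) (dg * df).
Proof.
move=> gP /is_derive_lineP fP; apply/is_derive_lineP.
by apply: (@is_derive1_comp _ g (fun h => f (h *: v + a))); rewrite ?scale0r ?add0r.
Qed.

(** Existence and value of the partial derivatives in one relation, so that calculus rules compose
    without separate derivability goals. It does not assert Fréchet differentiability. *)
Definition has_grad (R : realType) (d : nat) (f : 'rV[R]_d -> R)
    (a w : 'rV[R]_d) : Prop :=
  forall u : 'I_d, is_derive a (delta_mx 0 u) f (w 0 u).

Lemma has_gradP (R : realType) (d : nat) (f : 'rV[R]_d -> R)
    (a w : 'rV[R]_d) :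
  has_grad f a w <-> has_partials f a /\ grad f a = w.
Proof.
split=> [fP|[fP <-] u]; last by rewrite mxE; apply: derivableP.
split=> [u|]; first exact: (@ex_derive _ _ _ _ _ _ _ (fP u)).
by apply/rowP => u; rewrite mxE (@derive_val _ _ _ _ _ _ _ (fP u)).
Qed.

(** Trades an explicit gradient for [grad f a], the form in which [delta_eta] and [delta_alpha] are
    defined. *)
Lemma has_grad_grad (R : realType) (d : nat) (f : 'rV[R]_d -> R)
    (a w : 'rV[R]_d) :
  has_grad f a w -> has_grad f a (grad f a).
Proof. by case/has_gradP => ? _; exact/has_gradP. Qed.

Lemma has_grad_comp (R : realType) (d : nat) (g : R -> R) (f : 'rV[R]_d -> R)
    (a w : 'rV[R]_d) (dg : R) :
  is_derive (f a) 1 g dg -> has_grad f a w ->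
  has_grad (fun e => g (f e)) a (dg *: w).
Proof. by move=> gP fP u; rewrite mxE; apply: is_derive_comp. Qed.

Lemma has_gradZ (R : realType) (d : nat) (k : R) (f : 'rV[R]_d -> R)
    (a w : 'rV[R]_d) :
  has_grad f a w -> has_grad (fun e => k * f e) a (k *: w).
Proof. by move=> fP u; rewrite mxE; apply: is_deriveZ. Qed.

Lemma has_grad_sum (R : realType) (d n : nat) (f : 'I_n -> 'rV[R]_d -> R)
    (a : 'rV[R]_d) (w : 'I_n -> 'rV[R]_d) :
  (forall i, has_grad (f i) a (w i)) ->
  has_grad (fun e => \sum_(i < n) f i e) a (\sum_(i < n) w i).
Proof.
move=> fP u; rewrite summxE.
rewrite (_ : (fun e => _) = \sum_(i < n) f i); last first.
  by apply/funext => e; rewrite fct_sumE.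
by apply: is_derive_sum => i; exact: fP.
Qed.

Lemma has_grad_coord (R : realType) (d : nat) (j : 'I_d) (a : 'rV[R]_d) :
  has_grad (fun e => e 0 j) a (delta_mx 0 j).
Proof.
move=> u; apply/is_derive_lineP.
rewrite (_ : (fun h => _) =
    fun h => ((delta_mx 0 u : 'rV[R]_d) 0 j) * h + a 0 j); last first.
  by apply/funext => h; rewrite !mxE mulrC.
rewrite (_ : _ 0 u = (delta_mx 0 u : 'rV[R]_d) 0 j * 1 + 0); last first.
  by rewrite mulr1 addr0 !mxE eq_sym.
by apply: is_deriveD.
Qed.

(** Fermat's rule on each coordinate line through [a]: the restriction [g] has a minimum at [0]. *)
Lemma grad_at_min (R : realType) (d : nat) (f : 'rV[R]_d -> R) (a : 'rV[R]_d) :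
  (forall b, has_partials f b) -> (forall b, f a <= f b) -> grad f a = 0.
Proof.
move=> fP fmin; apply/rowP => u; rewrite !mxE.
pose v : 'rV[R]_d := delta_mx 0 u; pose g t : R := f (t *: v + a).
(* Derivability is needed on a whole interval around [0]; at [h] it comes from the partial
   derivative of [f] at the shifted point [h *: v + a]. *)
have dg (h : R) : derivable g h 1.
  apply: (derivable1P g h 1).2.
  rewrite (_ : (fun t => _) = fun t : R => f (t *: v + (h *: v + a))).
    exact: (derivable1P f (h *: v + a) v).1 (fP _ u).
  by apply/funext => t; rewrite /g scalerDl addrA [_%:A]mulr1.
suff : is_derive a (delta_mx 0 u) f 0 by case.
(* Any open interval around [0] would do in place of []-1, 1[]. *)
apply/is_derive_lineP; apply: (@derive1_at_min _ g (-1) 1 0).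
- by rewrite (le_trans (lerN10 R)).
- by move=> h _; exact: dg.
- by rewrite in_itv/= oppr_lt0 ltr01.
- by move=> t _; rewrite /g scale0r add0r.
Qed.

(** * One-variable derivatives: [gam], powers and the divergence *)

Lemma gam_gt0 (R : realType) (t : R) : 0 < gam t.
Proof. by rewrite /gam subr_gt0 expR_lt1 oppr_lt0 expR_gt0. Qed.

Lemma gam_lt1 (R : realType) (t : R) : gam t < 1.
Proof. by rewrite /gam gtrBl expR_gt0. Qed.

Lemma is_derive_gam (R : realType) (t : R) :
  is_derive t 1 (@gam R) (expR t * expR (- expR t)).
Proof.
have hN : is_derive t 1 (fun y : R => - expR y) (- expR t) by apply: is_deriveN.
have hE := is_derive_comp (g := expR) (f := fun y : R => - expR y)
  (is_derive_expR (- expR t)) hN.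
rewrite (_ : expR t * _ = 0 - expR (- expR t) * - expR t); last by ring.
exact: (is_deriveB (is_derive_cst (1 : R) t 1) hE).
Qed.

Lemma is_derive_powRr (R : realType) (b t : R) : 0 < b ->
  is_derive t 1 (fun y => b `^ y) (b `^ t * ln b).
Proof.
(* [powR] treats base [0] separately; [0 < b] selects the exponential branch. *)
move=> b0; have powE y : b `^ y = expR (ln b * y).
  by rewrite /powR gt_eqF// mulrC.
under eq_fun do rewrite powE; rewrite powE.
apply: is_derive_comp; rewrite -[X in is_derive _ _ _ X]mulr1.
exact: is_deriveZ.
Qed.

Lemma is_derive1_onem (R : realType) (t : R) : is_derive t 1 (fun y : R => 1 - y) (- 1).
Proof.
rewrite -[X in is_derive _ _ _ X]add0r.
exact: (is_deriveB (is_derive_cst (1 : R) t 1) (is_derive_id t 1)).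
Qed.

Lemma is_derive_mul_ln_div (R : realType) (p t : R) : 0 <= p -> 0 < t ->
  is_derive t 1 (fun y => p * ln (p / y)) (- (p / t)).
Proof.
(* For [p = 0] the chain rule would need [ln] at [0], where it is not differentiable; but the factor
   [p] makes the function constantly zero. *)
rewrite le_eqVlt => /predU1P[<- _|p0 t0].
  rewrite mul0r oppr0; under eq_fun do rewrite mul0r.
  exact: is_derive_cst.
have dln : is_derive (p / t) 1 (@ln R) (p / t)^-1.
  by apply: is_derive1_ln; exact: divr_gt0.
have dV : is_derive t 1 (fun y : R => p * y^-1) (p * - t ^- 2).
  apply: is_deriveZ; rewrite -[X in is_derive _ _ _ X]mulr1.
  by apply: is_deriveV; rewrite gt_eqF.
rewrite (_ : - _ = p * ((p / t)^-1 * (p * - t ^- 2))); last first.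
  by field; rewrite !gt_eqF.
by apply: is_deriveZ; exact: is_derive_comp.
Qed.

Lemma is_derive_dpd (R : realType) (beta p1 p2 t : R) :
  0 <= beta -> 0 <= p1 -> 0 <= p2 -> p1 + p2 = 1 -> 0 < t < 1 ->
  is_derive t 1 (fun y => dpd beta p1 p2 (1 - y) y)
    (- (beta + 1) * ((1 - t - p1) *
       ((1 - t) `^ (beta - 1) + t `^ (beta - 1)))).
Proof.
move=> beta0 p10 p20 p12 /andP[t0 t1].
have t1' : 0 < 1 - t by rewrite subr_gt0.
have p2E : p2 = 1 - p1 by rewrite -p12 addrC addKr.
rewrite /dpd; have [->|betaN0] := eqVneq beta 0.
  rewrite (_ : _ * _ = - (p1 / (1 - t)) * (- 1) + - (p2 / t)); last first.
    (* The exponent [beta - 1] is now [-1], so the powers are inverses and the identity is one of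
       rational functions. *)
    rewrite !add0r !powRN !powRr1 ?ltW// p2E.
    by field; rewrite !gt_eqF.
  apply: is_deriveD; last exact: is_derive_mul_ln_div.
  exact: (is_derive_comp (g := fun y => p1 * ln (p1 / y)) (f := fun y : R => 1 - y)
    (is_derive_mul_ln_div p10 t1') (is_derive1_onem t)).
have dpow (b : R) : is_derive t 1 (fun y => y `^ b) (b * t `^ (b - 1)).
  exact: is_derive1_powR.
have dpow1 (b : R) :
    is_derive t 1 (fun y => (1 - y) `^ b) (b * (1 - t) `^ (b - 1) * (- 1)).
  apply: (is_derive_comp (g := fun y => y `^ b) (f := fun y : R => 1 - y)).
    exact: is_derive1_powR.
  exact: is_derive1_onem.
have {}beta0 : 0 < beta by rewrite lt_neqAle eq_sym betaN0.
rewrite (_ : - (beta + 1) * _ =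
    ((beta + 1) * (1 - t) `^ (beta + 1 - 1) * (- 1) +
     (beta + 1) * t `^ (beta + 1 - 1)) -
    (beta + 1) / beta *
      (p1 * (beta * (1 - t) `^ (beta - 1) * (- 1)) +
       p2 * (beta * t `^ (beta - 1)))); last first.
  (* Writing [t]^ beta[as]t * t [^ (beta - 1)], and likewise for [1 - t], leaves only powers of
     exponent [beta - 1], which [field] treats as atoms. *)
  rewrite !addrK -(mulr_powRB1 (ltW t0) beta0) -(mulr_powRB1 (ltW t1') beta0) p2E.
  by field.
exact: is_deriveB.
Qed.

(** * The products [G i] and the reliability *)

Lemma G_gt0 (R : realType) (I : nat) (i : 'I_I) (eta : 'rV[R]_I) : 0 < G i eta.
Proof. by apply: prodr_gt0 => m _; exact: gam_gt0. Qed.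

(** The factor [m = i] is always present and is below 1; the others are at most 1. *)
Lemma G_lt1 (R : realType) (I : nat) (i : 'I_I) (eta : 'rV[R]_I) : G i eta < 1.
Proof.
rewrite /G (bigD1 i)//= (le_lt_trans _ (gam_lt1 (eta 0 i)))//.
rewrite ler_piMr ?(ltW (gam_gt0 _))//.
by apply: Num.Theory.prodr_ile1 => m _; rewrite !ltW ?gam_gt0 ?gam_lt1.
Qed.

Lemma has_grad_G (R : realType) (I : nat) (i : 'I_I) (eta : 'rV[R]_I) :
  has_grad (G i) eta
    (\row_u if (i <= u)%N
            then expR (eta 0 u) * expR (- expR (eta 0 u)) *
                 (G i eta / gam (eta 0 u))
            else 0).
Proof.
move=> u; rewrite mxE; case: ifPn => iu; apply/is_derive_lineP; last first.
  (* If [u < i], no factor of [G i] involves coordinate [u]. *)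
  rewrite (_ : (fun h => _) = cst (G i eta)); first exact: is_derive_cst.
  apply/funext => h; apply: eq_bigr => m im; rewrite !mxE eqxx/=.
  by rewrite (negbTE (_ : m != u)) ?mulr0 ?add0r//; apply: contraNneq iu => <-.
(* [C] collects the factors that do not depend on coordinate [u], so it equals
   [G i eta / gam (eta 0 u)]. *)
set C := \prod_(m < I | (i <= m)%N && (m != u)) gam (eta 0 m).
have GE : G i eta = C * gam (eta 0 u) by rewrite mulrC /G (bigD1 u).
rewrite GE mulfK ?gt_eqF ?gam_gt0//.
rewrite (_ : (fun h => _) = fun h => C * gam (eta 0 u + h)); last first.
  apply/funext => h; rewrite mulrC /G (bigD1 u)//= !mxE !eqxx mulr1 addrC.
  congr *%R; apply: eq_bigr => m /andP[_ /negbTE mu].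
  by rewrite !mxE mu andbF mulr0 add0r.
rewrite mulrC; apply: is_deriveZ.
rewrite -[X in is_derive _ _ _ X]mulr1.
apply: is_derive_comp; first by rewrite addr0; exact: is_derive_gam.
by rewrite -[X in is_derive _ _ _ X]add0r; apply: is_deriveD.
Qed.

Lemma rel_at_itv (R : realType) (I J : nat) (i : 'I_I) (xs : 'rV[R]_J)
    (eta : 'rV[R]_I) (alpha : 'rV[R]_J) :
  0 < rel_at i xs eta alpha < 1.
Proof.
have G1 : 0 < 1 - G i eta by rewrite subr_gt0 G_lt1.
rewrite powR_gt0//= /rel_at /powR gt_eqF// expR_lt1.
by rewrite pmulr_rlt0 ?expR_gt0// ln_lt0// G1/= gtrBl G_gt0.
Qed.

(** Leaving [w] free allows both the explicit gradient of [G i] and [grad (G i) eta] to be plugged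
    in. *)
Lemma has_grad_rel_eta (R : realType) (I J : nat) (i : 'I_I) (xs : 'rV[R]_J)
    (eta : 'rV[R]_I) (alpha : 'rV[R]_J) (w : 'rV[R]_I) :
  has_grad (G i) eta w ->
  has_grad (fun e => rel_at i xs e alpha) eta
    (- ((1 - G i eta) `^ (lam xs alpha - 1) * lam xs alpha) *: w).
Proof.
move=> GP; rewrite [_ * lam _ _]mulrC -[- (lam _ _ * _)]mulrN1.
apply: (has_grad_comp (g := fun y => (1 - y) `^ lam xs alpha)) => //.
apply: (is_derive_comp (g := fun y => y `^ lam xs alpha) (f := fun y : R => 1 - y)).
  by apply: is_derive1_powR; rewrite subr_gt0 G_lt1.
exact: is_derive1_onem.
Qed.

Lemma has_grad_lam (R : realType) (J : nat) (xs alpha : 'rV[R]_J) :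
  has_grad (lam xs) alpha (lam xs alpha *: xs).
Proof.
(* The exponent is linear in [alpha]; expanding [xs] in the standard basis matches its gradient term
   by term. *)
apply: has_grad_comp; rewrite [X in has_grad _ _ X]row_sum_delta.
apply: has_grad_sum => j; under eq_fun do rewrite mulrC.
exact/has_gradZ/has_grad_coord.
Qed.

Lemma has_grad_rel_alpha (R : realType) (I J : nat) (i : 'I_I) (xs : 'rV[R]_J)
    (eta : 'rV[R]_I) (alpha : 'rV[R]_J) :
  has_grad (fun a => rel_at i xs eta a) alpha
    (((1 - G i eta) `^ lam xs alpha * ln (1 - G i eta) * lam xs alpha) *: xs).
Proof.
rewrite -scalerA; apply: has_grad_comp (has_grad_lam _ _).
by apply: is_derive_powRr; rewrite subr_gt0 G_lt1.
Qed.

(** * The objective and the estimating equations *)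

(** Stated for an arbitrary family [r] of functions with values in []0, 1[] at [a], so that one
    computation serves both the [eta] and the [alpha] gradients. *)
Lemma has_grad_sum_dpd (R : realType) (I S d : nat) (K n : 'I_I -> 'I_S -> nat)
    (beta : R) (r : 'I_I -> 'I_S -> 'rV[R]_d -> R) (a : 'rV[R]_d)
    (w : 'I_I -> 'I_S -> 'rV[R]_d) :
  (forall i s, (1 <= K i s)%N) -> (forall i s, (n i s <= K i s)%N) ->
  0 <= beta -> (forall i s, 0 < r i s a < 1) ->
  (forall i s, has_grad (r i s) a (w i s)) ->
  has_grad
    (fun e => \sum_(i < I) \sum_(s < S) (K i s)%:R / (Ktot K)%:R *
       dpd beta ((n i s)%:R / (K i s)%:R)
         (((K i s)%:R - (n i s)%:R) / (K i s)%:R) (1 - r i s e) (r i s e)) a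
    (- (beta + 1) / (Ktot K)%:R *: \sum_(i < I) \sum_(s < S)
       (((K i s)%:R * (1 - r i s a) - (n i s)%:R) *
        ((1 - r i s a) `^ (beta - 1) + r i s a `^ (beta - 1))) *: w i s).
Proof.
move=> K_ge1 n_le beta_ge0 r01 rP; rewrite scaler_sumr.
apply: has_grad_sum => i; rewrite scaler_sumr; apply: has_grad_sum => s.
have K0 : (K i s)%:R != 0 :> R by rewrite pnatr_eq0 -lt0n.
set p1 := (n i s)%:R / _; set p2 := (_ - _) / _.
have p1_ge0 : 0 <= p1 by rewrite divr_ge0.
have p2_ge0 : 0 <= p2 by rewrite divr_ge0// subr_ge0 ler_nat.
have p12 : p1 + p2 = 1 by rewrite /p1 /p2 -mulrDl subrKC divff.
have dpdP := is_derive_dpd beta_ge0 p1_ge0 p2_ge0 p12 (r01 i s).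
have := has_gradZ ((K i s)%:R / (Ktot K)%:R) (has_grad_comp dpdP (rP i s)).
congr has_grad; rewrite !scalerA; congr (_ *: _).
(* The weight [K i s] is absorbed here: [K (1 - r - p1)] becomes [K (1 - r) - n]. *)
have -> : (n i s)%:R = (K i s)%:R * p1 by rewrite mulrC divfK.
ring.
Qed.

Theorem theorem7 (R : realType) (I S J : nat)
    (I_ge1 : (1 <= I)%N) (S_ge1 : (1 <= S)%N) (J_ge1 : (1 <= J)%N)
    (IT : 'I_I -> R) (IT_gt0 : forall i, 0 < IT i)
    (IT_incr : forall i j : 'I_I, (i < j)%N -> IT i < IT j)
    (x : 'I_S -> 'rV[R]_J)
    (K n : 'I_I -> 'I_S -> nat)
    (K_ge1 : forall i s, (1 <= K i s)%N)
    (n_le : forall i s, (n i s <= K i s)%N)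
    (beta : R) (beta_ge0 : 0 <= beta) :
  (forall (eta : 'rV[R]_I) (alpha : 'rV[R]_J),
     is_wmdpde x K n beta eta alpha ->
     grad (fun e => Dobj x K n beta e alpha) eta = 0 /\
     grad (fun a => Dobj x K n beta eta a) alpha = 0)
  /\
  forall (eta : 'rV[R]_I) (alpha : 'rV[R]_J),
    let Ris (i : 'I_I) (s : 'I_S) := rel_at i (x s) eta alpha in
    [/\ has_partials (fun e => Dobj x K n beta e alpha) eta /\
        (grad (fun e => Dobj x K n beta e alpha) eta = 0 <->
         \sum_(i < I) \sum_(s < S)
           (((K i s)%:R * (1 - Ris i s) - (n i s)%:R) *
            ((1 - Ris i s) `^ (beta - 1) + Ris i s `^ (beta - 1)))
             *: delta_eta i (x s) eta alpha = 0),
        has_partials (fun a => Dobj x K n beta eta a) alpha /\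
        (grad (fun a => Dobj x K n beta eta a) alpha = 0 <->
         \sum_(i < I) \sum_(s < S)
           (((K i s)%:R * (1 - Ris i s) - (n i s)%:R) *
            ((1 - Ris i s) `^ (beta - 1) + Ris i s `^ (beta - 1)))
             *: delta_alpha i (x s) eta alpha = 0),
        forall (i : 'I_I) (s : 'I_S),
          has_partials (fun e => rel_at i (x s) e alpha) eta /\
          delta_eta i (x s) eta alpha =
            - ((1 - G i eta) `^ (lam (x s) alpha - 1) * lam (x s) alpha)
              *: grad (G i) eta,
        forall (i : 'I_I) (s : 'I_S),
          has_partials (fun a => rel_at i (x s) eta a) alpha /\
          delta_alpha i (x s) eta alpha =
            ((1 - G i eta) `^ lam (x s) alpha * ln (1 - G i eta) *
             lam (x s) alpha) *: x s
      & forall i : 'I_I,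
          has_partials (G i) eta /\
          forall u : 'I_I,
            grad (G i) eta 0 u =
              if (i <= u)%N
              then expR (eta 0 u) * expR (- expR (eta 0 u)) *
                   (G i eta / gam (eta 0 u))
              else 0].
Proof.
have retaP (i : 'I_I) s eta alpha := has_grad_rel_eta (x s) alpha (has_grad_G i eta).
have ralphaP (i : 'I_I) s eta alpha := has_grad_rel_alpha i (x s) eta alpha.
(* [has_grad_grad] makes the vectors in the sum [delta_eta] (below, [delta_alpha]) rather than their
   closed forms. *)
have DetaP eta alpha := has_grad_sum_dpd K_ge1 n_le beta_ge0
  (fun i s => rel_at_itv i (x s) eta alpha)
  (fun i s => has_grad_grad (retaP i s eta alpha)).
have DalphaP eta alpha := has_grad_sum_dpd K_ge1 n_le beta_ge0
  (fun i s => rel_at_itv i (x s) eta alpha)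
  (fun i s => has_grad_grad (ralphaP i s eta alpha)).
have c_neq0 : - (beta + 1) / (Ktot K)%:R != 0.
  have K0 : (0 < Ktot K)%N.
    (* Isolating the term at the first time and first stress level already gives a positive
       total. *)
    rewrite /Ktot (bigD1 (Ordinal I_ge1))//= (bigD1 (Ordinal S_ge1))//=.
    by rewrite !addn_gt0 K_ge1.
  by rewrite mulf_neq0 ?invr_eq0 ?oppr_eq0 ?pnatr_eq0 -?lt0n// gt_eqF ?ltr_wpDl.
have scale0 m (v : 'rV[R]_m) :
    - (beta + 1) / (Ktot K)%:R *: v = 0 <-> v = 0.
  split=> [/eqP|->]; last exact: scaler0.
  by rewrite scaler_eq0 (negbTE c_neq0) => /eqP.
split=> [eta alpha Dmin|eta alpha /=].
  (* A joint minimizer also minimizes over each block with the other block frozen. *)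
  split; apply: grad_at_min => b.
  - by case/has_gradP: (DetaP b alpha).
  - exact: Dmin.
  - by case/has_gradP: (DalphaP eta b).
  - exact: Dmin.
split.
- have /has_gradP[? ->] := DetaP eta alpha.
  by split=> //; exact: scale0.
- have /has_gradP[? ->] := DalphaP eta alpha.
  by split=> //; exact: scale0.
- move=> i s; apply/has_gradP; apply: has_grad_rel_eta.
  exact: has_grad_grad (has_grad_G i eta).
- by move=> i s; apply/has_gradP.
- move=> i; have /has_gradP[? ->] := has_grad_G i eta.
  by split=> // u; rewrite mxE.
Qed.
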